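(* Let $K$ be a perfect field, let $V_1,\dots,V_d,W_1,\dots,W_e$ be finite-dimensional $K$-vector spaces, $\alpha\in\mathbb{R}^d_{>0}$ and $\beta\in\mathbb{R}^e_{>0}$. Let $v\in V_1\otimes\cdots\otimes V_d$ and $w\in W_1\otimes\cdots\otimes W_e$, and let $v\otimes w\in V_1\otimes\cdots\otimes V_d\otimes W_1\otimes\cdots\otimes W_e$ be the horizontal tensor product (a tensor with $d+e$ factors). Then $$\operatorname{rk}^G_{\alpha,\beta}(v\otimes w)=\min\{\operatorname{rk}^G_\alpha(v),\operatorname{rk}^G_\beta(w)\},$$ where $(\alpha,\beta)=(\alpha_1,\dots,\alpha_d,\beta_1,\dots,\beta_e)\in\mathbb{R}^{d+e}_{>0}$.
   Context: $G$-stable rank of a tensor $u\in U=U_1\otimes\cdots\otimes U_k$ ($U_i$ finite-dimensional over $K$) with weight $\gamma\in\mathbb{R}^k_{>0}$: for a $K$-vector space $W$ and $v(t)\in K((t))\otimes W$, $\operatorname{val}_t(v(t))$ is the largest integer $m$ with $v(t)\in t^m(K[[t]]\otimes W)$, and $\operatorname{val}_t(0)=\infty$. Let $\mathrm{GL}(U_i,K[[t]])$ be the set of elements of $K[[t]]\otimes\operatorname{End}(U_i)$ that are invertible over $K((t))$ (the inverse need not have entries in $K[[t]]$), and $G(K[[t]])=\prod_{i=1}^k\mathrm{GL}(U_i,K[[t]])$, acting on $K((t))\otimes U$ factorwise. Then $\operatorname{rk}^G_\gamma(u)$ is the infimum of $$\mu_\gamma(g(t),u)=\frac{\sum_{i=1}^k\gamma_i\operatorname{val}_t(\det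 g_i(t))}{\operatorname{val}_t(g(t)\cdot u)}$$ over all $g(t)=(g_1(t),\dots,g_k(t))\in G(K[[t]])$ with $\operatorname{val}_t(g(t)\cdot u)>0$ (a quotient with denominator $\infty$ is $0$). *)

(* Defs.v *)
From HB Require Import structures.
From mathcomp Require Export all_boot all_order all_algebra all_field.
From mathcomp Require Export fraction.
From mathcomp Require Export all_classical all_reals ereal.

Set Implicit Arguments.
Unset Strict Implicit.
Unset Printing Implicit Defensive.

Import Order.TTheory GRing.Theory Num.Theory.
Local Open Scope classical_set_scope.
Local Open Scope ring_scope.

(******************************************************************************)
(* Tensors are written in coordinates: U_i = K^(n i), so U_1 (x) ... (x) U_k  *)
(* is the space of arrays indexed by prod_i 'I_(n i), and linear maps are     *)
(* matrices acting on column vectors.                                         *)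
(*           fps K == the ring K[[t]] of formal power series                  *)
(*       laurent K == the field K((t)), as the fraction field of K[[t]]       *)
(*    tensor R n   == R (x) (K^(n 1) (x) ... (x) K^(n k))                     *)
(*       tact g u  == (g_1 (x) ... (x) g_k) u                                 *)
(*       valt w    == val_t of w in K((t)) (x) K^X                            *)
(*     GL_series g <-> g is in prod_i GL(U_i, K[[t]])                         *)
(*       rkG gam u == the G-stable rank rk^G_gam(u)                           *)
(*     htensor v w == the horizontal tensor product of v and w                *)
(******************************************************************************)

Definition perfect_field (K : fieldType) : Prop :=
  forall p : {poly K}, irreducible_poly p -> separable_poly p.

Section PowerSeries.
Variable K : fieldType.

Record fps : Type := Fps { fps_coef : nat -> K }.

HB.instance Definition _ := gen_eqMixin fps.
HB.instance Definition _ := gen_choiceMixin fps.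

Implicit Types a b c : fps.

Lemma fpsP a b : (forall n, fps_coef a n = fps_coef b n) -> a = b.
Proof. by case: a b => [a] [b] /= /funext ->. Qed.

Definition fps_zero := Fps (fun=> 0).
Definition fps_opp a := Fps (fun n => - fps_coef a n).
Definition fps_add a b := Fps (fun n => fps_coef a n + fps_coef b n).
Definition fps_one := Fps (fun n => (n == 0%N)%:R).
Definition fps_mul a b :=
  Fps (fun n => \sum_(j < n.+1) fps_coef a j * fps_coef b (n - j)).

Fact fps_addA : associative fps_add.
Proof. by move=> a b c; apply: fpsP => n /=; rewrite addrA. Qed.
Fact fps_addC : commutative fps_add.
Proof. by move=> a b; apply: fpsP => n /=; rewrite addrC. Qed.
Fact fps_add0 : left_id fps_zero fps_add.
Proof. by move=> a; apply: fpsP => n /=; rewrite add0r. Qed.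
Fact fps_addN : left_inverse fps_zero fps_opp fps_add.
Proof. by move=> a; apply: fpsP => n /=; rewrite addNr. Qed.

HB.instance Definition _ :=
  GRing.isZmodule.Build fps fps_addA fps_addC fps_add0 fps_addN.

Let trunc n a := \poly_(i < n.+1) fps_coef a i.

Let coef_mul_trunc m a b n : (n <= m)%N ->
  fps_coef (fps_mul a b) n = (trunc m a * trunc m b)`_n.
Proof.
move=> le_nm; rewrite coefM /=; apply: eq_bigr => j _.
have le_jm : (j <= m)%N by apply: leq_trans le_nm; rewrite -ltnS.
by rewrite !coef_poly !ltnS le_jm (leq_trans (leq_subr _ _) le_nm).
Qed.

Fact fps_mulC : commutative fps_mul.
Proof.
by move=> a b; apply: fpsP => n; rewrite !(@coef_mul_trunc n) // mulrC.
Qed.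

Fact fps_mulA : associative fps_mul.
Proof.
move=> a b c; apply: fpsP => n.
have -> : fps_coef (fps_mul a (fps_mul b c)) n
    = (trunc n a * (trunc n b * trunc n c))`_n.
  rewrite coefM; apply: eq_bigr => j _; rewrite coef_poly ltn_ord.
  by rewrite (@coef_mul_trunc n) // leq_subr.
have -> : fps_coef (fps_mul (fps_mul a b) c) n
    = (trunc n a * trunc n b * trunc n c)`_n.
  rewrite coefM; apply: eq_bigr => j _; rewrite [in RHS]coef_poly ltnS leq_subr.
  by rewrite (@coef_mul_trunc n) // -ltnS.
by rewrite mulrA.
Qed.

Fact fps_mul1 : left_id fps_one fps_mul.
Proof.
move=> a; apply: fpsP => n /=; rewrite big_ord_recl /= mul1r subn0.
by rewrite big1 ?addr0 // => i _; rewrite mul0r.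
Qed.

Fact fps_mulDl : left_distributive fps_mul +%R.
Proof.
move=> a b c; apply: fpsP => n /=; rewrite -big_split.
by apply: eq_bigr => i _ /=; rewrite mulrDl.
Qed.

Fact fps_one_neq0 : fps_one != 0.
Proof.
by apply/eqP => /(congr1 (fps_coef ^~ 0%N)) /eqP; rewrite /= oner_eq0.
Qed.

HB.instance Definition _ := GRing.Zmodule_isComNzRing.Build fps
  fps_mulA fps_mulC fps_mul1 fps_mulDl fps_one_neq0.

Definition fps_unit : pred fps := fun a => `[< exists b, b * a = 1 >].
Definition fps_inv a : fps :=
  if pselect (exists b, b * a = 1) is left e then xget 0 [set b | b * a = 1]
  else a.

Fact fps_mulVr : {in fps_unit, left_inverse 1 fps_inv *%R}.
Proof.
move=> a /asboolP [b ba]; rewrite /fps_inv.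
case: pselect => [_|]; last by case; exists b.
exact: (@xgetPex _ 0 [set b | b * a = 1]) (ex_intro _ b ba).
Qed.

Fact fps_unitP a b : b * a = 1 -> fps_unit a.
Proof. by move=> ba; apply/asboolP; exists b. Qed.

Fact fps_inv_out : {in [predC fps_unit], fps_inv =1 id}.
Proof.
move=> a /asboolPn na; rewrite /fps_inv.
by case: pselect => // e; case: na.
Qed.

HB.instance Definition _ := GRing.ComNzRing_hasMulInverse.Build fps
  fps_mulVr fps_unitP fps_inv_out.

Lemma fps_neq0P a : a != 0 -> 
  exists2 n, fps_coef a n != 0 & forall m, (m < n)%N -> fps_coef a m = 0.
Proof.
move=> a0; have ex : exists n, fps_coef a n != 0.
  apply: contrapT => H; case/eqP: a0; apply: fpsP => n; apply: contrapT => an.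
  by apply: H; exists n; apply/eqP.
case: (ex_minnP ex) => n an min; exists n => // m; apply: contraTeq => /min.
by rewrite leqNgt.
Qed.

Fact fps_integral : GRing.integral_domain_axiom fps.
Proof.
move=> a b ab; apply: contrapT => /negP; rewrite negb_or => /andP[].
move=> /fps_neq0P[i ai mina] /fps_neq0P[j bj minb].
have /eqP := congr1 (fps_coef ^~ (i + j)%N) ab.
have lti : (i < (i + j).+1)%N by rewrite ltnS leq_addr.
rewrite /= (bigD1 (Ordinal lti)) //= addKn big1 ?addr0 ?mulf_eq0; last first.
  move=> k; rewrite -val_eqE /= neq_ltn => /orP[/mina ->|ik]; first exact: mul0r.
  rewrite minb ?mulr0 // ltn_subLR; first by rewrite ltn_add2r.
  by rewrite -ltnS.
by rewrite (negPf ai) (negPf bj).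
Qed.

HB.instance Definition _ := GRing.ComUnitRing_isIntegral.Build fps fps_integral.

Definition fpsC (x : K) : fps := Fps (fun n => if n == 0%N then x else 0).
Definition fpsX : fps := Fps (fun n => (n == 1%N)%:R).

Definition laurent : fieldType := {fraction fps}.

End PowerSeries.

Section Tensor.
Variables (R : comNzRingType) (k : nat) (n : 'I_k -> nat).

Definition tensor : Type := {ffun {dffun forall i, 'I_(n i)} -> R}.

Definition tact (g : forall i, 'M[R]_(n i)) (u : tensor) : tensor :=
  [ffun x : {dffun forall i, 'I_(n i)} =>
     \sum_(y : {dffun forall i, 'I_(n i)}) (\prod_i g i (x i) (y i)) * u y].

End Tensor.

Section Valuation.
Variables (R : realType) (K : fieldType).
Local Open Scope ereal_scope.

(* w lies in t^m (K[[t]] (x) K^X) *)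
Definition in_lattice (X : finType) (m : int) (w : {ffun X -> laurent K}) :=
  forall x, exists a : fps K, w x = (tofrac (fpsX K) ^ m * tofrac a)%R.

(* The supremum is a maximum when w != 0, and is +oo when w = 0. *)
Definition valt (X : finType) (w : {ffun X -> laurent K}) : \bar R :=
  ereal_sup [set (m%:~R)%:E | m in [set m : int | in_lattice m w]].

Definition valt1 (f : laurent K) : \bar R := valt [ffun _ : unit => f].

Variables (k : nat) (n : 'I_k -> nat).

Definition to_laurent (g : forall i, 'M[fps K]_(n i)) i : 'M[laurent K]_(n i) :=
  map_mx (@tofrac (fps K)) (g i).

Definition const_tensor (u : tensor K n) : tensor (laurent K) n :=
  [ffun x => tofrac (fpsC (u x))].

Definition GL_series (g : forall i, 'M[fps K]_(n i)) : Prop :=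
  forall i, to_laurent g i \in unitmx.

Definition series_act (g : forall i, 'M[fps K]_(n i)) (u : tensor K n) :
  tensor (laurent K) n := tact (to_laurent g) (const_tensor u).

(* In \bar R, x / +oo = 0. *)
Definition mu_slope (gam : 'I_k -> R) (g : forall i, 'M[fps K]_(n i))
    (u : tensor K n) : \bar R :=
  (\sum_(i < k) (gam i)%:E * valt1 (\det (to_laurent g i)))
    / valt (series_act g u).

(* For k = 0 and u != 0 no g is admissible, and the infimum is +oo. *)
Definition rkG (gam : 'I_k -> R) (u : tensor K n) : \bar R :=
  ereal_inf [set mu_slope gam g u | g in
    [set g | GL_series g /\ 0 < valt (series_act g u)]].

End Valuation.

Section Horizontal.
Variables (d e : nat).

Definition fam_cat (T : Type) (f : 'I_d -> T) (g : 'I_e -> T)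
    (i : 'I_(d + e)) : T :=
  match fintype.split i with inl a => f a | inr b => g b end.

Lemma fam_catl T (f : 'I_d -> T) (g : 'I_e -> T) a :
  fam_cat f g (lshift e a) = f a.
Proof. by rewrite /fam_cat (unsplitK (inl a)). Qed.

Lemma fam_catr T (f : 'I_d -> T) (g : 'I_e -> T) b :
  fam_cat f g (rshift d b) = g b.
Proof. by rewrite /fam_cat (unsplitK (inr b)). Qed.

Variables (R : comNzRingType) (n : 'I_d -> nat) (m : 'I_e -> nat).

Definition htensor (v : tensor R n) (w : tensor R m) :
    tensor R (fam_cat n m) :=
  [ffun x : {dffun forall i, 'I_(fam_cat n m i)} =>
     v [ffun a => cast_ord (fam_catl n m a) (x (lshift e a))] *
     w [ffun b => cast_ord (fam_catr n m b) (x (rshift d b))]].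

End Horizontal.

(* Main.v *)
Require Import Defs.
From mathcomp Require Import all_boot all_order all_algebra all_classical all_reals ereal.

(** The tensor v (x) w has d + e factors, so an element of G(K[[t]]) for it is
    a pair (g, h), and (g, h).(v (x) w) = g.v (x) h.w (tact_htensor).  The
    valuation of a horizontal product is the sum of the valuations, because
    the entries of g.v (x) h.w are all the products of an entry of g.v by an
    entry of h.w, and the lowest-order terms of power series over a field
    multiply to something nonzero (valt_tofracM).  The numerator of the slope
    splits as well, so with

      A = sum_i alpha_i val(det g_i),   a = val(g.v),
      B = sum_j beta_j val(det h_j),    b = val(h.w),

    all four being nonnegative, the slope of (g, h) at v (x) w is the mediant
    (A + B) / (a + b).

    Taking h = 1 gives A / (a + b) <= A / a, hence rk(v (x) w) <= rk(v), and
    symmetrically for w (rkG_htensor_lel, rkG_htensor_ler).  Conversely a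
    mediant is at least the smaller of A / a and B / b (le_mediant).  When one
    of a, b vanishes, say b = 0, the pair may be admissible although h is not
    admissible for w; the mediant is then still at least A / a since
    B >= 0. *)

Set Implicit Arguments.
Unset Strict Implicit.
Unset Printing Implicit Defensive.
Import Order.TTheory GRing.Theory Num.Theory.
Local Open Scope ring_scope.

(** * Orders of power series *)

Lemma coef_fpsXn_mul (K : fieldType) (k i : nat) (b : fps K) :
  fps_coef (fpsX K ^+ k * b) i = if (i < k)%N then 0 else fps_coef b (i - k).
Proof.
elim: k i => [|k IHk] i; first by rewrite expr0 mul1r subn0.
have coefXM c : fps_coef (fpsX K * c) i
    = if i is j.+1 then fps_coef c j else 0.
  case: i => [|i] /=; first by rewrite big_ord1 mul0r.
  rewrite (bigD1 (lift ord0 ord0)) //= mul1r subSS subn0.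
  rewrite big1 ?addr0 // => j; rewrite -val_eqE /= => /negPf ->.
  by rewrite mul0r.
rewrite exprS -mulrA coefXM; case: i {coefXM} => [|i]; first by [].
by rewrite IHk ltnS subSS.
Qed.

Lemma fps_factor (K : fieldType) (a : fps K) (k : nat) :
  (forall i, (i < k)%N -> fps_coef a i = 0) ->
  exists2 b, a = fpsX K ^+ k * b & fps_coef b 0 = fps_coef a k.
Proof.
move=> ak; exists (Fps (fun i => fps_coef a (i + k))) => //.
apply: fpsP => i; rewrite coef_fpsXn_mul.
by case: ltnP => [/ak //|leki] /=; rewrite subnK.
Qed.

Lemma fps_family_order (K : fieldType) (X : finType) (f : X -> fps K) :
  (forall x, f x = 0) \/
  exists k x, fps_coef (f x) k != 0 /\
    forall y i, (i < k)%N -> fps_coef (f y) i = 0.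
Proof.
have [[k fk]|nof] := pselect (exists k, [exists x, fps_coef (f x) k != 0]).
  right; have ex : exists k, [exists x, fps_coef (f x) k != 0] by exists k.
  case: (ex_minnP ex) => l /existsP[x fxl] lmin; exists l, x; split=> // y i.
  apply: contraTeq => fyi; rewrite -leqNgt; apply: lmin.
  by apply/existsP; exists y.
left=> x; apply: fpsP => k; apply: contrapT => fxk; apply: nof; exists k.
by apply/existsP; exists x; apply/eqP.
Qed.

(** * The valuation of families of power series *)

(** For a family of series, lying in t^k K[[t]] can be tested on coefficients:
    a quotient by t^k taken in K((t)) is again a power series. *)
Lemma in_lattice_tofracP (K : fieldType) (X : finType) (f : X -> fps K)
    (k : nat) :
  in_lattice k%:Z [ffun x => tofrac (f x)]
  <-> forall x i, (i < k)%N -> fps_coef (f x) i = 0.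
Proof.
split=> [H x i ltik | H x].
  have [a] := H x; rewrite ffunE -exprnP -rmorphXn -rmorphM => /eqP.
  by rewrite tofrac_eq => /eqP ->; rewrite coef_fpsXn_mul ltik.
have [b fxE _] := fps_factor (H x).
by exists b; rewrite ffunE fxE -exprnP -rmorphXn -rmorphM.
Qed.

Lemma le_valt (R : realType) (K : fieldType) (X : finType) (p : int)
    (u : {ffun X -> laurent K}) :
  in_lattice p u -> ((p%:~R)%:E <= valt R u)%E.
Proof. by move=> pu; apply: ereal_sup_ubound; exists p. Qed.

Lemma valt_tofrac_ge0 (R : realType) (K : fieldType) (X : finType)
    (f : X -> fps K) :
  (0 <= valt R [ffun x => tofrac (f x)])%E.
Proof. by apply: (@le_valt _ _ _ 0); apply/in_lattice_tofracP. Qed.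

Lemma valt_tofrac0 (R : realType) (K : fieldType) (X : finType)
    (f : X -> fps K) :
  (forall x, f x = 0) -> valt R [ffun x => tofrac (f x)] = +oo%E.
Proof.
move=> f0; apply/eqyP => A A0.
apply: (@le_trans _ _ ((((Num.bound A)%:Z)%:~R)%:E)).
  by rewrite lee_fin -pmulrn ltW // archi_boundP // ltW.
by apply: le_valt; apply/in_lattice_tofracP => x i _; rewrite f0.
Qed.

Lemma valt_tofrac_order (R : realType) (K : fieldType) (X : finType)
    (f : X -> fps K) (k : nat) (x : X) :
  fps_coef (f x) k != 0 ->
  (forall y i, (i < k)%N -> fps_coef (f y) i = 0) ->
  valt R [ffun x => tofrac (f x)] = (k%:R)%:E.
Proof.
move=> fxk f_k; apply/eqP; rewrite eq_le; apply/andP; split; last first.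
  by rewrite [k%:R]pmulrn; apply: le_valt; apply/in_lattice_tofracP.
apply/ereal_supP => _ [[p|p] pf <-]; rewrite lee_fin; last first.
  by rewrite NegzE mulrNz; apply: (@le_trans _ _ 0); rewrite ?oppr_le0 -?pmulrn.
rewrite -pmulrn ler_nat leqNgt; apply: contra fxk => ltkp.
by move/in_lattice_tofracP: pf => ->.
Qed.

(** Additivity of the valuation, for a family indexed by Z whose entries are
    the products f x * g y: the maps l and r stand for the projections of an
    index of the product onto its two halves, and surjectivity of (l, r) makes
    the product of two entries of minimal order occur in the family. *)
Lemma valt_tofracM (R : realType) (K : fieldType) (X Y Z : finType)
    (l : Z -> X) (r : Z -> Y) (f : X -> fps K) (g : Y -> fps K) :
  (forall x y, exists z, l z = x /\ r z = y) ->
  valt R [ffun z => tofrac (f (l z) * g (r z))]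
  = (valt R [ffun x => tofrac (f x)] + valt R [ffun y => tofrac (g y)])%E.
Proof.
move=> lr.
(* Rules out the indeterminate sum +oo + -oo when a family is zero. *)
have ge0Ny (X' : finType) (h : X' -> fps K) :
    valt R [ffun x => tofrac (h x)] != -oo%E.
  by rewrite -ltNye (lt_le_trans _ (valt_tofrac_ge0 R h)) ?ltNyr.
have [f0|[p [x [fxp f_p]]]] := fps_family_order f.
  rewrite (valt_tofrac0 R f0) addye //.
  by apply: valt_tofrac0 => z; rewrite f0 mul0r.
have [g0|[q [y [gyq g_q]]]] := fps_family_order g.
  rewrite (valt_tofrac0 R g0) addey //.
  by apply: valt_tofrac0 => z; rewrite g0 mulr0.
(* After dividing f by t^p and g by t^q, the constant term of each product is
   the product of the leading coefficients, nonzero at the entry (x, y). *)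
have fgE z : exists2 c, f (l z) * g (r z) = fpsX K ^+ (p + q) * c
    & fps_coef c 0 = fps_coef (f (l z)) p * fps_coef (g (r z)) q.
  have [a -> <-] := fps_factor (f_p (l z)).
  have [b -> <-] := fps_factor (g_q (r z)).
  by exists (a * b); rewrite ?exprD 1?mulrACA //= big_ord1.
rewrite (valt_tofrac_order R fxp f_p) (valt_tofrac_order R gyq g_q).
rewrite -EFinD -natrD; have [z [lz rz]] := lr x y.
apply: (@valt_tofrac_order _ _ _ _ _ z) => [|z' i ltipq].
  have [c -> c0] := fgE z; rewrite coef_fpsXn_mul ltnn subnn c0 lz rz.
  by rewrite mulf_neq0.
by have [c -> _] := fgE z'; rewrite coef_fpsXn_mul ltipq.
Qed.

(** * Splitting indices and matrices along the concatenation *)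

Definition lpart (d e : nat) (n : 'I_d -> nat) (m : 'I_e -> nat)
    (x : {dffun forall i, 'I_(fam_cat n m i)}) : {dffun forall a, 'I_(n a)} :=
  [ffun a => cast_ord (fam_catl n m a) (x (lshift e a))].

Definition rpart (d e : nat) (n : 'I_d -> nat) (m : 'I_e -> nat)
    (x : {dffun forall i, 'I_(fam_cat n m i)}) : {dffun forall b, 'I_(m b)} :=
  [ffun b => cast_ord (fam_catr n m b) (x (rshift d b))].

(** The match is repeated in the return type, so that unfolding fam_cat makes
    it well typed without any cast; casts only appear when the result is
    evaluated at an index known to lie in one of the two halves. *)
Definition glue (F : nat -> Type) (d e : nat) (n : 'I_d -> nat)
    (m : 'I_e -> nat) (f : forall a, F (n a)) (g : forall b, F (m b))
    (i : 'I_(d + e)) : F (fam_cat n m i) :=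
  match fintype.split i as s
    return F (match s with inl a => n a | inr b => m b end)
  with inl a => f a | inr b => g b end.

Lemma glue_lshift (F : nat -> Type) (d e : nat) (n : 'I_d -> nat)
    (m : 'I_e -> nat) (f : forall a, F (n a)) (g : forall b, F (m b)) a :
  glue f g (lshift e a) = eq_rect_r F (f a) (fam_catl n m a).
Proof.
move: (fam_catl n m a); rewrite /fam_cat /glue.
by rewrite (unsplitK (inl a)) => E; rewrite (eq_irrelevance E erefl).
Qed.

Lemma glue_rshift (F : nat -> Type) (d e : nat) (n : 'I_d -> nat)
    (m : 'I_e -> nat) (f : forall a, F (n a)) (g : forall b, F (m b)) b :
  glue f g (rshift d b) = eq_rect_r F (g b) (fam_catr n m b).
Proof.
move: (fam_catr n m b); rewrite /fam_cat /glue.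
by rewrite (unsplitK (inr b)) => E; rewrite (eq_irrelevance E erefl).
Qed.

Definition glue_idx (d e : nat) (n : 'I_d -> nat) (m : 'I_e -> nat)
    (p : {dffun forall a, 'I_(n a)} * {dffun forall b, 'I_(m b)}) :
    {dffun forall i, 'I_(fam_cat n m i)} :=
  [ffun i => glue (F := ordinal) p.1 p.2 i].

Lemma glue_idxK (d e : nat) (n : 'I_d -> nat) (m : 'I_e -> nat) :
  cancel (@glue_idx d e n m) (fun x => (lpart x, rpart x)).
Proof.
have cancel_cast k k' (E : k' = k) (z : 'I_k) :
  cast_ord E (eq_rect_r ordinal z E) = z by subst k; apply: val_inj.
move=> [x y]; congr pair; apply/ffunP => i; rewrite !ffunE /=.
  by rewrite glue_lshift cancel_cast.
by rewrite glue_rshift cancel_cast.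
Qed.

Lemma parts_inj (d e : nat) (n : 'I_d -> nat) (m : 'I_e -> nat) :
  injective (fun x : {dffun forall i, 'I_(fam_cat n m i)} =>
               (lpart x, rpart x)).
Proof.
move=> x y [/ffunP xyl /ffunP xyr]; apply/ffunP => i.
case: (split_ordP i) => [a|b] ->.
  by have := xyl a; rewrite !ffunE; apply: cast_ord_inj.
by have := xyr b; rewrite !ffunE; apply: cast_ord_inj.
Qed.

Lemma sum_parts (V : nmodType) (d e : nat) (n : 'I_d -> nat) (m : 'I_e -> nat)
    (F : {dffun forall a, 'I_(n a)} -> {dffun forall b, 'I_(m b)} -> V) :
  \sum_x \sum_y F x y
  = \sum_(z : {dffun forall i, 'I_(fam_cat n m i)}) F (lpart z) (rpart z).
Proof.
rewrite pair_bigA /= (reindex (fun z : {dffun forall i, 'I_(fam_cat n m i)} =>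
                               (lpart z, rpart z))) //=.
apply: onW_bij; exists (@glue_idx d e n m); last exact: glue_idxK.
exact: inj_can_sym (@glue_idxK _ _ _ _) (@parts_inj _ _ _ _).
Qed.

Definition lmx (S : Type) (d e : nat) (n : 'I_d -> nat) (m : 'I_e -> nat)
    (g : forall i, 'M[S]_(fam_cat n m i)) a : 'M[S]_(n a) :=
  castmx (fam_catl n m a, fam_catl n m a) (g (lshift e a)).

Definition rmx (S : Type) (d e : nat) (n : 'I_d -> nat) (m : 'I_e -> nat)
    (g : forall i, 'M[S]_(fam_cat n m i)) b : 'M[S]_(m b) :=
  castmx (fam_catr n m b, fam_catr n m b) (g (rshift d b)).

(** Elements of the group for v (x) w are the same as pairs of elements of the
    groups for v and for w. *)
Lemma exists_glue_mx (S : Type) (d e : nat) (n : 'I_d -> nat)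
    (m : 'I_e -> nat) (g : forall a, 'M[S]_(n a)) (h : forall b, 'M[S]_(m b)) :
  exists G : forall i, 'M[S]_(fam_cat n m i),
    (forall a, lmx G a = g a) /\ (forall b, rmx G b = h b).
Proof.
have cancel_cast k k' (E : k' = k) (A : 'M[S]_k) :
    castmx (E, E) (eq_rect_r (fun k => 'M[S]_k) A E) = A.
  by subst k; rewrite castmx_id.
exists (glue (F := fun k => 'M[S]_k) g h); rewrite /lmx /rmx.
by split=> i; rewrite ?glue_lshift ?glue_rshift cancel_cast.
Qed.

(** * The action on a horizontal product *)

(** Distributivity: the sum over the indices of v (x) w is a double sum, and
    the product over the d + e factors of the matrix entries splits. *)
Lemma tact_htensor (S : comNzRingType) (d e : nat) (n : 'I_d -> nat)
    (m : 'I_e -> nat) (g : forall i, 'M[S]_(fam_cat n m i))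
    (v : tensor S n) (w : tensor S m) :
  tact g (htensor v w) = htensor (tact (lmx g) v) (tact (rmx g) w).
Proof.
apply/ffunP => x; rewrite !ffunE big_distrlr /= sum_parts.
apply: eq_bigr => y _; rewrite ffunE mulrACA big_split_ord /=.
congr (_ * _ * _); apply: eq_bigr => i _.
  by rewrite /lmx castmxE !ffunE !cast_ordK.
by rewrite /rmx castmxE !ffunE !cast_ordK.
Qed.

Lemma const_tensor_htensor (K : fieldType) (d e : nat) (n : 'I_d -> nat)
    (m : 'I_e -> nat) (v : tensor K n) (w : tensor K m) :
  const_tensor (htensor v w) = htensor (const_tensor v) (const_tensor w).
Proof.
apply/ffunP => x; rewrite !ffunE -rmorphM; congr tofrac; apply: fpsP => -[|i].
  by rewrite /= big_ord1.
rewrite /= big1 // => -[[|j] ltj] _ /=; last by rewrite mul0r.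
by rewrite mulr0.
Qed.

Lemma to_laurent_lmx (K : fieldType) (d e : nat) (n : 'I_d -> nat)
    (m : 'I_e -> nat) (g : forall i, 'M[fps K]_(fam_cat n m i)) a :
  to_laurent (lmx g) a = lmx (to_laurent g) a.
Proof. exact: map_castmx. Qed.

Lemma to_laurent_rmx (K : fieldType) (d e : nat) (n : 'I_d -> nat)
    (m : 'I_e -> nat) (g : forall i, 'M[fps K]_(fam_cat n m i)) b :
  to_laurent (rmx g) b = rmx (to_laurent g) b.
Proof. exact: map_castmx. Qed.

Lemma series_act_htensor (K : fieldType) (d e : nat) (n : 'I_d -> nat)
    (m : 'I_e -> nat) (g : forall i, 'M[fps K]_(fam_cat n m i))
    (v : tensor K n) (w : tensor K m) :
  series_act g (htensor v w)
  = htensor (series_act (lmx g) v) (series_act (rmx g) w).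
Proof.
rewrite /series_act const_tensor_htensor tact_htensor; congr htensor.
  congr tact; apply/functional_extensionality_dep => a.
  by rewrite to_laurent_lmx.
congr tact; apply/functional_extensionality_dep => b.
by rewrite to_laurent_rmx.
Qed.

(** Integrality of g.u, which reduces valuations of the orbit to orders of
    power series and makes them nonnegative. *)
Lemma series_act_tofrac (K : fieldType) (k : nat) (n : 'I_k -> nat)
    (g : forall i, 'M[fps K]_(n i)) (u : tensor K n) :
  exists f : {dffun forall i, 'I_(n i)} -> fps K,
    series_act g u = [ffun x => tofrac (f x)].
Proof.
exists (fun x => \sum_(y : {dffun forall i, 'I_(n i)})
  (\prod_i g i (x i) (y i)) * fpsC (u y)).
apply/ffunP => x; rewrite !ffunE rmorph_sum; apply: eq_bigr => y _.
rewrite ffunE rmorphM rmorph_prod; congr (_ * _); apply: eq_bigr => i _.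
by rewrite mxE.
Qed.

Lemma valt_series_act_htensor (R : realType) (K : fieldType) (d e : nat)
    (n : 'I_d -> nat) (m : 'I_e -> nat)
    (g : forall i, 'M[fps K]_(fam_cat n m i))
    (v : tensor K n) (w : tensor K m) :
  valt R (series_act g (htensor v w))
  = (valt R (series_act (lmx g) v) + valt R (series_act (rmx g) w))%E.
Proof.
rewrite series_act_htensor.
have [f ->] := series_act_tofrac (lmx g) v.
have [h ->] := series_act_tofrac (rmx g) w.
rewrite -(@valt_tofracM _ _ _ _ _ (@lpart d e n m) (@rpart d e n m)).
  by congr valt; apply/ffunP => z; rewrite !ffunE rmorphM.
by move=> x y; exists (glue_idx (x, y)); case: (glue_idxK (x, y)).
Qed.

Lemma valt_series_act_ge0 (R : realType) (K : fieldType) (k : nat)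
    (n : 'I_k -> nat) (g : forall i, 'M[fps K]_(n i)) (u : tensor K n) :
  (0 <= valt R (series_act g u))%E.
Proof. by have [f ->] := series_act_tofrac g u; apply: valt_tofrac_ge0. Qed.

Lemma det_castmx (S : comNzRingType) (k k' : nat) (E : k = k') (A : 'M[S]_k) :
  \det (castmx (E, E) A) = \det A.
Proof. by subst k'; rewrite castmx_id. Qed.

(** * The slope *)

(** The numerator of the slope mu_slope. *)
Definition det_weight (R : realType) (K : fieldType) (k : nat)
    (n : 'I_k -> nat) (gam : 'I_k -> R) (g : forall i, 'M[fps K]_(n i)) :
    \bar R :=
  (\sum_(i < k) (gam i)%:E * valt1 R (\det (to_laurent g i)))%E.

Lemma det_weight_ge0 (R : realType) (K : fieldType) (k : nat)
    (n : 'I_k -> nat) (gam : 'I_k -> R) (g : forall i, 'M[fps K]_(n i)) :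
  (forall i, 0 < gam i) -> (0 <= det_weight gam g)%E.
Proof.
move=> gam0; apply: sume_ge0 => i _; apply: mule_ge0.
  by rewrite lee_fin ltW.
by rewrite /valt1 /to_laurent det_map_mx; apply: valt_tofrac_ge0.
Qed.

Lemma det_weight_fam_cat (R : realType) (K : fieldType) (d e : nat)
    (n : 'I_d -> nat) (m : 'I_e -> nat) (alpha : 'I_d -> R) (beta : 'I_e -> R)
    (g : forall i, 'M[fps K]_(fam_cat n m i)) :
  det_weight (fam_cat alpha beta) g
  = (det_weight alpha (lmx g) + det_weight beta (rmx g))%E.
Proof.
rewrite /det_weight big_split_ord /=.
by congr (_ + _)%E; apply: eq_bigr => i _;
  rewrite (fam_catl, fam_catr) (to_laurent_lmx, to_laurent_rmx) det_castmx.
Qed.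

Lemma GL_series_parts (K : fieldType) (d e : nat)
    (n : 'I_d -> nat) (m : 'I_e -> nat)
    (g : forall i, 'M[fps K]_(fam_cat n m i)) :
  GL_series g <-> GL_series (lmx g) /\ GL_series (rmx g).
Proof.
split=> [GLg | [GLl GLr] i].
  split=> i; first by have := GLg (lshift e i);
    rewrite to_laurent_lmx !unitmxE det_castmx.
  by have := GLg (rshift d i); rewrite to_laurent_rmx !unitmxE det_castmx.
case: (split_ordP i) => [a|b] ->.
  by have := GLl a; rewrite to_laurent_lmx !unitmxE det_castmx.
by have := GLr b; rewrite to_laurent_rmx !unitmxE det_castmx.
Qed.

Lemma GL_series1 (K : fieldType) (k : nat) (n : 'I_k -> nat) :
  GL_series (fun i => 1%:M : 'M[fps K]_(n i)).
Proof. by move=> i; rewrite /to_laurent map_mx1 unitmx1. Qed.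

Lemma det_weight1 (R : realType) (K : fieldType) (k : nat) (n : 'I_k -> nat)
    (gam : 'I_k -> R) :
  det_weight gam (fun i => 1%:M : 'M[fps K]_(n i)) = 0%E.
Proof.
rewrite /det_weight big1 // => i _.
rewrite /to_laurent map_mx1 det1 /valt1 -(rmorph1 (@tofrac (fps K))).
by rewrite (@valt_tofrac_order _ _ _ _ 0 tt) ?mule0 //= oner_eq0.
Qed.

Lemma rkG_ge0 (R : realType) (K : fieldType) (k : nat) (n : 'I_k -> nat)
    (gam : 'I_k -> R) (u : tensor K n) :
  (forall i, 0 < gam i) -> (0 <= rkG gam u)%E.
Proof.
move=> gam0; apply/ereal_infP => _ [g _ <-].
by rewrite mule_ge0 ?inve_ge0 ?valt_series_act_ge0 ?(det_weight_ge0 g gam0).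
Qed.

(** * Mediants in the extended reals *)

(** Stated for a possibly infinite or zero denominator: for a = 0 the
    conclusion is 0 <= A, for a = +oo the quotient is 0 and forces r = 0. *)
Lemma le_pdiv_mul (R : realType) (r A a : \bar R) :
  (0 <= r -> 0 <= A -> 0 <= a -> (0 < a -> r <= A / a) -> r * a <= A)%E.
Proof.
move=> r0 A0; rewrite le_eqVlt => /orP[/eqP <- _|a0 /(_ a0)].
  by rewrite mule0.
case: a a0 => [a||//] a0; last first.
  by rewrite invey mule0 => rle0; rewrite (@le_anti _ _ r 0%E) ?mul0e ?rle0.
by rewrite inver gt_eqF // lee_pdivlMr.
Qed.

(** Only a positive denominator contributes a hypothesis on its quotient: this
    is the form needed when one of the two components is not admissible. *)
Lemma le_mediant (R : realType) (r A B a b : \bar R) :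
  (0 <= r -> 0 <= A -> 0 <= B -> 0 <= a -> 0 <= b -> 0 < a + b ->
   (0 < a -> r <= A / a) -> (0 < b -> r <= B / b) ->
   r <= (A + B) / (a + b))%E.
Proof.
move=> r0 A0 B0 a0 b0 ab0 rA rB.
have [aby|abNy] := eqVneq (a + b)%E +oo%E.
  rewrite aby invey mule0.
  have : (a = +oo \/ b = +oo)%E.
    by move: aby; case: a b {rA rB ab0} a0 b0 => [a||//] [b||//]; auto.
  case=> [ay|yb].
    by have := rA; rewrite ay invey mule0; apply; rewrite ltry.
  by have := rB; rewrite yb invey mule0; apply; rewrite ltry.
have : (r * (a + b) <= A + B)%E.
  by rewrite ge0_muleDr // leeD // le_pdiv_mul.
case: (a + b)%E ab0 abNy => [c||] //= c0 _.
by rewrite inver gt_eqF // lee_pdivlMr.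
Qed.

(** * Rank of a horizontal product *)

(** A group element for v is completed by identity matrices on the factors of
    w: these have weight 0 and can only increase the valuation. *)
Lemma rkG_htensor_lel (R : realType) (K : fieldType) (d e : nat)
    (n : 'I_d -> nat) (m : 'I_e -> nat) (alpha : 'I_d -> R) (beta : 'I_e -> R)
    (v : tensor K n) (w : tensor K m) :
  (forall i, 0 < alpha i) ->
  (rkG (fam_cat alpha beta) (htensor v w) <= rkG alpha v)%E.
Proof.
move=> gam0; apply/ereal_infP => _ [g [GLg val0] <-].
have [G [Gl Gr]] := exists_glue_mx g (fun j => 1%:M : 'M[fps K]_(m j)).
have {}Gl : lmx G = g by apply/functional_extensionality_dep.
have {}Gr : rmx G = fun j => 1%:M by apply/functional_extensionality_dep.
have le_val :
    (valt R (series_act g v) <= valt R (series_act G (htensor v w)))%E.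
  by rewrite valt_series_act_htensor Gl Gr leeDl // valt_series_act_ge0.
apply: ge_ereal_inf; exists (mu_slope (fam_cat alpha beta) G (htensor v w)).
  exists G => //; split; last exact: lt_le_trans le_val.
  by apply/GL_series_parts; rewrite Gl Gr; split=> //; apply: GL_series1.
rewrite /mu_slope -!/(det_weight _ _) det_weight_fam_cat Gl Gr det_weight1.
rewrite adde0 lee_wpmul2l ?det_weight_ge0 //.
by rewrite lee_pV2 // inE ?valt_series_act_ge0.
Qed.

Lemma rkG_htensor_ler (R : realType) (K : fieldType) (d e : nat)
    (n : 'I_d -> nat) (m : 'I_e -> nat) (alpha : 'I_d -> R) (beta : 'I_e -> R)
    (v : tensor K n) (w : tensor K m) :
  (forall j, 0 < beta j) ->
  (rkG (fam_cat alpha beta) (htensor v w) <= rkG beta w)%E.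
Proof.
move=> gam0; apply/ereal_infP => _ [g [GLg val0] <-].
have [G [Gl Gr]] := exists_glue_mx (fun i => 1%:M : 'M[fps K]_(n i)) g.
have {}Gl : lmx G = fun i => 1%:M by apply/functional_extensionality_dep.
have {}Gr : rmx G = g by apply/functional_extensionality_dep.
have le_val :
    (valt R (series_act g w) <= valt R (series_act G (htensor v w)))%E.
  by rewrite valt_series_act_htensor Gl Gr leeDr // valt_series_act_ge0.
apply: ge_ereal_inf; exists (mu_slope (fam_cat alpha beta) G (htensor v w)).
  exists G => //; split; last exact: lt_le_trans le_val.
  by apply/GL_series_parts; rewrite Gl Gr; split=> //; apply: GL_series1.
rewrite /mu_slope -!/(det_weight _ _) det_weight_fam_cat Gl Gr det_weight1.
rewrite add0e lee_wpmul2l ?det_weight_ge0 //.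
by rewrite lee_pV2 // inE ?valt_series_act_ge0.
Qed.

Theorem proposition3p4 (R : realType) (K : fieldType) (hK : perfect_field K)
    (d e : nat) (n : 'I_d -> nat) (m : 'I_e -> nat)
    (alpha : 'I_d -> R) (beta : 'I_e -> R)
    (halpha : forall i, 0 < alpha i) (hbeta : forall j, 0 < beta j)
    (v : tensor K n) (w : tensor K m) :
  rkG (fam_cat alpha beta) (htensor v w)
  = Order.min (rkG alpha v) (rkG beta w).
Proof.
apply/eqP; rewrite eq_le; apply/andP; split.
  by rewrite le_min rkG_htensor_lel ?rkG_htensor_ler.
apply/ereal_infP => _ [G [/GL_series_parts[GLl GLr] ab0] <-].
rewrite valt_series_act_htensor in ab0.
rewrite /mu_slope -/(det_weight _ _) det_weight_fam_cat valt_series_act_htensor.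
apply: le_mediant => //; rewrite ?det_weight_ge0 ?valt_series_act_ge0 //.
- by rewrite le_min !rkG_ge0.
- move=> a0; rewrite ge_min; apply/orP; left.
  by apply: ereal_inf_lbound; exists (lmx G).
- move=> b0; rewrite ge_min; apply/orP; right.
  by apply: ereal_inf_lbound; exists (rmx G).
Qed.
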